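(* Let $(\mathbb{C},\mathcal{N})$ be a star-regular category in which every regular epimorphism is saturating, which has enough trivial objects, and in which $\mathcal{N}$-trivial objects are closed under binary products. The following conditions are equivalent: (a) $\mathbb{C}$ is a $2$-star-permutable category, i.e. $\mathsf{Eq}(f)\,\mathsf{Eq}(g)^{\ast}=\mathsf{Eq}(g)\,\mathsf{Eq}(f)^{\ast}$ for any pair of regular epimorphisms $f$ and $g$ in $\mathbb{C}$ with the same domain; (b) the Star-Upper Cuboid Lemma holds true in $\mathbb{C}$ (that is, for every star-cuboid diagram in $\mathbb{C}$, if its lower row is a star-exact sequence then so is its upper row).
   Context: A regular category is a finitely complete category in which every kernel pair has a coequaliser and regular epimorphisms are pullback-stable. An ideal $\mathcal{N}$ is a class of morphisms such that $g\cdot f\in\mathcal{N}$ whenever $g\in\mathcal{N}$ or $f\in\mathcal{N}$. A multi-pointed category is a finitely complete category $\mathbb{C}$ with an ideal $\mathcal{N}$. An $\mathcal{N}$-kernel of $f\colon X\to Y$ is a morphism $\mathrm{n}_f\colon \mathrm{N}_f\to X$ universal with $f\cdot \mathrm{n}_f\in\mathcal{N}$ (it is a monomorphism). ''With kernels'' means every morphism has an $\mathcal{N}$-kernel. A star is a pair of parallel morphisms $\sigma=(\sigma_1,\sigma_2)\colon S\rightrightarrows X$ with $\sigma_1\in\mathcal{N}$. A star-regular category is a regular multi-pointed category with kernels in which every regular epimorphism is a coequaliser of a star. Relations: a relation $\varrho$ from $X$ to $Y$ is a subobject $\langle\varrho_1,\varrho_2\rangle\colon R\rightarrowtail X\times Y$,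 with opposite $\varrho^{\circ}=\langle\varrho_2,\varrho_1\rangle$; $\sigma\varrho$ is the usual composite (first $\varrho$, then $\sigma$); a morphism $f\colon X\to Y$ is identified with the relation $\langle 1_X,f\rangle$. $\mathsf{Eq}(f)=f^{\circ}f$ is the kernel pair of $f$. $\Delta_X^{\ast}=(\mathrm{n}_{1_X},\mathrm{n}_{1_X})$, and $\varrho^{\ast}=\varrho\,\Delta_X^{\ast}=(\varrho_1\cdot\mathrm{n}_{\varrho_1},\varrho_2\cdot\mathrm{n}_{\varrho_1})$, the largest subrelation of $\varrho$ with first component in $\mathcal{N}$. The star-kernel of $f\colon X\to Y$ is the universal star $\sigma$ on $X$ with $f\cdot\sigma_1=f\cdot\sigma_2$; it is $\mathsf{Eq}(f)^{\ast}\rightrightarrows X$. Saturating: $f\colon X\to Y$ is saturating when the induced morphism $\mathrm{N}_{1_X}\to \mathrm{N}_{1_Y}$ between the $\mathcal{N}$-kernels of $1_X$ and $1_Y$ (commuting with $f$, $\mathrm{n}_{1_X}$, $\mathrm{n}_{1_Y}$) is a regular epimorphism. Trivial objects: $X$ is $\mathcal{N}$-trivial when $1_X\in\mathcal{N}$. $\mathbb{C}$ has enough trivial objects when every morphism in $\mathcal{N}$ factors through an $\mathcal{N}$-trivial object, and the class of $\mathcal{N}$-trivial objects is closed under subobjects and under squares ($X$ trivial implies $X\times X$ trivial). Star of a pullback relation: for $\delta\colon W\to D$ and $g\colon C\to D$, the star of the pullback relation of $(g,\delta)$ is the universal relation $(\nu_1,\nu_2)\colon (W\times_D C)^{\ast}\rightarrowtail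 W\times C$ from $W$ to $C$ with $\nu_1\in\mathcal{N}$ and $\delta\cdot\nu_1=g\cdot\nu_2$; explicitly $\nu_i=\pi_i\cdot \mathrm{n}_{\pi_1}$, where $\pi_1,\pi_2$ are the pullback projections of $W\times_D C$ to $W$ and $C$. Star-exact sequence: a diagram $K\rightrightarrows X\xrightarrow{f}Y$ in which the parallel pair is a star-kernel of $f$ and $f$ is a coequaliser of this pair (by star-regularity, the latter is the same as $f$ being a regular epimorphism). Star-cuboid diagram: it consists of the following commuting data in $\mathbb{C}$. - Two star-exact middle rows $(w_1,w_2)\colon\mathsf{Eq}(w)^{\ast}\rightrightarrows W\xrightarrow{w}Y$ and $(c_1,c_2)\colon\mathsf{Eq}(c)^{\ast}\rightrightarrows C\xrightarrow{c}A$. - A lower row consisting of a star $(\sigma_1,\sigma_2)\colon S\rightrightarrows D$ and a morphism $d\colon D\to B$. - Regular epimorphisms $\bar g\colon\mathsf{Eq}(c)^{\ast}\to S$, $g\colon C\to D$, $f\colon A\to B$ and arbitrary morphisms $\bar\delta\colon\mathsf{Eq}(w)^{\ast}\to S$, $\delta\colon W\to D$, $\beta\colon Y\to B$ such that $\sigma_i\cdot\bar g=g\cdot c_i$ and $\sigma_i\cdot\bar\delta=\delta\cdot w_i$ for $i=1,2$, $d\cdot g=f\cdot c$ and $d\cdot\delta=\beta\cdot w$. - The stars of pullback relations $(\tau_1,\tau_2)$ on $P=(\mathsf{Eq}(w)^{\ast}\times_S\mathsf{Eq}(c)^{\ast})^{\ast}$ of $(\bar g,\bar\delta)$, $(\nu_1,\nu_2)$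 on $(W\times_D C)^{\ast}$ of $(g,\delta)$, and $(\chi_1,\chi_2)$ on $(Y\times_B A)^{\ast}$ of $(f,\beta)$. - An upper row consisting of a star $(\pi_1,\pi_2)\colon P\rightrightarrows (W\times_D C)^{\ast}$ and a morphism $\lambda\colon(W\times_D C)^{\ast}\to(Y\times_B A)^{\ast}$ such that $\nu_1\cdot\pi_i=w_i\cdot\tau_1$ and $\nu_2\cdot\pi_i=c_i\cdot\tau_2$ for $i=1,2$, $\chi_1\cdot\lambda=w\cdot\nu_1$ and $\chi_2\cdot\lambda=c\cdot\nu_2$. *)

(* Defs.v *)
From Stdlib Require Import List.

Set Implicit Arguments.
Unset Strict Implicit.
Unset Printing Implicit Defensive.

Record category := Category {
  ob :> Type;
  hom : ob -> ob -> Type;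
  idm : forall X, hom X X;
  comp : forall X Y Z, hom Y Z -> hom X Y -> hom X Z;
  comp_idl : forall X Y (f : hom X Y), comp (idm Y) f = f;
  comp_idr : forall X Y (f : hom X Y), comp f (idm X) = f;
  comp_assoc : forall X Y Z W (h : hom Z W) (g : hom Y Z) (f : hom X Y),
    comp h (comp g f) = comp (comp h g) f
}.

Arguments hom {c} _ _.
Arguments idm {c} _.
Arguments comp {c X Y Z} _ _.

Declare Scope cat_scope.
Delimit Scope cat_scope with cat.
Notation "g ∘ f" := (comp g f) (at level 40, left associativity) : cat_scope.
Open Scope cat_scope.

Record functor (J C : category) := Functor {
  fob :> J -> C;
  fmap : forall i j : J, hom i j -> hom (fob i) (fob j);
  fmap_id : forall i, fmap (idm i) = idm (fob i);
  fmap_comp : forall i j k (b : hom j k) (a : hom i j),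
    fmap (b ∘ a) = fmap b ∘ fmap a
}.

Definition is_cone (J C : category) (F : functor J C)
    (L : C) (p : forall i : J, hom L (F i)) : Prop :=
  forall (i j : J) (a : hom i j), fmap F a ∘ p i = p j.

Definition is_limit (J C : category) (F : functor J C)
    (L : C) (p : forall i : J, hom L (F i)) : Prop :=
  is_cone p /\
  forall (T : C) (t : forall i : J, hom T (F i)), is_cone t ->
    exists! u : hom T L, forall i, p i ∘ u = t i.

Definition finite_type (T : Type) : Prop :=
  exists s : list T, forall x, In x s.

Definition finite_category (J : category) : Prop :=
  finite_type J /\ forall i j : J, finite_type (hom i j).

Definition finitely_complete (C : category) : Prop :=
  forall J : category, finite_category J ->
  forall F : functor J C,
  exists (L : C) (p : forall i : J, hom L (F i)), is_limit p.

Definition is_product (C : category) (X Y P : C)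
    (p1 : hom P X) (p2 : hom P Y) : Prop :=
  forall (T : C) (t1 : hom T X) (t2 : hom T Y),
    exists! u : hom T P, p1 ∘ u = t1 /\ p2 ∘ u = t2.

Definition is_pullback (C : category) (X Y Z P : C)
    (f : hom X Z) (g : hom Y Z) (p1 : hom P X) (p2 : hom P Y) : Prop :=
  f ∘ p1 = g ∘ p2 /\
  forall (T : C) (t1 : hom T X) (t2 : hom T Y), f ∘ t1 = g ∘ t2 ->
    exists! u : hom T P, p1 ∘ u = t1 /\ p2 ∘ u = t2.

Definition mono (C : category) (X Y : C) (m : hom X Y) : Prop :=
  forall (T : C) (u v : hom T X), m ∘ u = m ∘ v -> u = v.

Definition is_coequaliser (C : category) (S X Y : C)
    (s1 s2 : hom S X) (q : hom X Y) : Prop :=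
  q ∘ s1 = q ∘ s2 /\
  forall (T : C) (t : hom X T), t ∘ s1 = t ∘ s2 ->
    exists! u : hom Y T, u ∘ q = t.

Definition regular_epi (C : category) (X Y : C) (f : hom X Y) : Prop :=
  exists (S : C) (s1 s2 : hom S X), is_coequaliser s1 s2 f.

Definition is_kernel_pair (C : category) (X Y E : C)
    (f : hom X Y) (e1 e2 : hom E X) : Prop :=
  is_pullback f f e1 e2.

Definition regular_category (C : category) : Prop :=
  finitely_complete C /\
  (forall (X Y E : C) (f : hom X Y) (e1 e2 : hom E X),
     is_kernel_pair f e1 e2 ->
     exists (Q : C) (q : hom X Q), is_coequaliser e1 e2 q) /\
  (forall (X Y Z P : C) (f : hom X Z) (g : hom Y Z)
          (p1 : hom P X) (p2 : hom P Y),
     is_pullback f g p1 p2 -> regular_epi f -> regular_epi p2).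

Definition mor_class (C : category) : Type :=
  forall X Y : C, hom X Y -> Prop.

Definition ideal (C : category) (N : mor_class C) : Prop :=
  forall (X Y Z : C) (f : hom X Y) (g : hom Y Z),
    N Y Z g \/ N X Y f -> N X Z (g ∘ f).

Definition multi_pointed (C : category) (N : mor_class C) : Prop :=
  finitely_complete C /\ ideal N.

Definition is_kernel (C : category) (N : mor_class C) (X Y K : C)
    (f : hom X Y) (k : hom K X) : Prop :=
  N K Y (f ∘ k) /\
  forall (T : C) (t : hom T X), N T Y (f ∘ t) ->
    exists! u : hom T K, k ∘ u = t.

Definition with_kernels (C : category) (N : mor_class C) : Prop :=
  forall (X Y : C) (f : hom X Y), exists (K : C) (k : hom K X), is_kernel N f k.

Definition is_star (C : category) (N : mor_class C) (S X : C)
    (s1 s2 : hom S X) : Prop :=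
  N S X s1.

Definition star_regular (C : category) (N : mor_class C) : Prop :=
  regular_category C /\ multi_pointed N /\ with_kernels N /\
  forall (X Y : C) (f : hom X Y), regular_epi f ->
    exists (S : C) (s1 s2 : hom S X),
      is_star N s1 s2 /\ is_coequaliser s1 s2 f.

Definition is_star_kernel (C : category) (N : mor_class C) (S X Y : C)
    (f : hom X Y) (s1 s2 : hom S X) : Prop :=
  is_star N s1 s2 /\ f ∘ s1 = f ∘ s2 /\
  forall (T : C) (t1 t2 : hom T X), is_star N t1 t2 -> f ∘ t1 = f ∘ t2 ->
    exists! u : hom T S, s1 ∘ u = t1 /\ s2 ∘ u = t2.

Definition star_exact (C : category) (N : mor_class C) (S X Y : C)
    (s1 s2 : hom S X) (f : hom X Y) : Prop :=
  is_star_kernel N f s1 s2 /\ is_coequaliser s1 s2 f.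

Definition saturating (C : category) (N : mor_class C) (X Y : C)
    (f : hom X Y) : Prop :=
  forall (NX NY : C) (nX : hom NX X) (nY : hom NY Y) (u : hom NX NY),
    is_kernel N (idm X) nX -> is_kernel N (idm Y) nY ->
    nY ∘ u = f ∘ nX -> regular_epi u.

Definition trivial_object (C : category) (N : mor_class C) (X : C) : Prop :=
  N X X (idm X).

Definition trivial_closed_under_products
    (C : category) (N : mor_class C) : Prop :=
  forall (X Y P : C) (p1 : hom P X) (p2 : hom P Y),
    is_product p1 p2 ->
    trivial_object N X -> trivial_object N Y -> trivial_object N P.

Definition enough_trivial_objects (C : category) (N : mor_class C) : Prop :=
  (forall (X Y : C) (f : hom X Y), N X Y f ->
     exists (T : C) (a : hom X T) (b : hom T Y),
       trivial_object N T /\ f = b ∘ a) /\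
  (forall (X Y : C) (m : hom X Y),
     mono m -> trivial_object N Y -> trivial_object N X) /\
  (forall (X P : C) (p1 p2 : hom P X),
     is_product p1 p2 -> trivial_object N X -> trivial_object N P).

Record span (C : category) (X Y : C) := Span {
  apex : C;
  leg1 : hom apex X;
  leg2 : hom apex Y
}.

Definition is_relation (C : category) (X Y : C) (R : span X Y) : Prop :=
  forall (P : C) (p1 : hom P X) (p2 : hom P Y) (m : hom (apex R) P),
    is_product p1 p2 -> p1 ∘ m = leg1 R -> p2 ∘ m = leg2 R -> mono m.

(** Equality of relations as subobjects of [X × Y]. *)
Definition same_relation (C : category) (X Y : C) (R S : span X Y) : Prop :=
  exists (u : hom (apex R) (apex S)) (v : hom (apex S) (apex R)),
    u ∘ v = idm (apex S) /\ v ∘ u = idm (apex R) /\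
    leg1 S ∘ u = leg1 R /\ leg2 S ∘ u = leg2 R.

(** [T] is the composite [S R] ([R] first): [(leg1 T, leg2 T)] is the mono
    part of the regular epi-mono factorisation into [X × Z] of the span
    obtained by pulling back [leg1 S] along [leg2 R]. *)
Definition is_rel_comp (C : category) (X Y Z : C)
    (S : span Y Z) (R : span X Y) (T : span X Z) : Prop :=
  is_relation T /\
  exists (Q : C) (q1 : hom Q (apex R)) (q2 : hom Q (apex S))
         (e : hom Q (apex T)),
    is_pullback (leg2 R) (leg1 S) q1 q2 /\ regular_epi e /\
    leg1 T ∘ e = leg1 R ∘ q1 /\ leg2 T ∘ e = leg2 S ∘ q2.

(** [S] is [R^*]. *)
Definition is_rel_star (C : category) (N : mor_class C) (X Y : C)
    (R S : span X Y) : Prop :=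
  exists n : hom (apex S) (apex R),
    is_kernel N (leg1 R) n /\ leg1 S = leg1 R ∘ n /\ leg2 S = leg2 R ∘ n.

Definition is_Eq (C : category) (X Y : C) (f : hom X Y) (E : span X X) : Prop :=
  is_kernel_pair f (leg1 E) (leg2 E).

Definition two_star_permutable (C : category) (N : mor_class C) : Prop :=
  forall (X Y Z : C) (f : hom X Y) (g : hom X Z),
    regular_epi f -> regular_epi g ->
  forall Ef Eg Ef_star Eg_star S T : span X X,
    is_Eq f Ef -> is_rel_star N Ef Ef_star ->
    is_Eq g Eg -> is_rel_star N Eg Eg_star ->
    is_rel_comp Ef Eg_star S -> is_rel_comp Eg Ef_star T ->
    same_relation S T.

(** Universal among all spans from [W] to [A] with first leg in [N] over [D].
    Uniqueness makes it a relation; it is [(p1 ∘ n, p2 ∘ n)] for the pullback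
    projections [p1], [p2] and the [N]-kernel [n] of [p1]. *)
Definition is_star_pullback (C : category) (N : mor_class C) (W A D P : C)
    (g : hom A D) (delta : hom W D) (nu1 : hom P W) (nu2 : hom P A) : Prop :=
  N P W nu1 /\ delta ∘ nu1 = g ∘ nu2 /\
  forall (T : C) (t1 : hom T W) (t2 : hom T A),
    N T W t1 -> delta ∘ t1 = g ∘ t2 ->
    exists! u : hom T P, nu1 ∘ u = t1 /\ nu2 ∘ u = t2.

(** [sc_Ew], [sc_Ec] are the objects [Eq(w)^*], [Eq(c)^*]; [sc_P], [sc_V],
    [sc_U] are the vertices of the stars of the pullback relations of
    [(gbar, dbar)], [(g, delta)] and [(f, beta)].  The equations
    [d ∘ sigma1 = d ∘ sigma2] and [lambda ∘ pi1 = lambda ∘ pi2] follow from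
    the other data, as [gbar] is epi and [(chi1, chi2)] is jointly monic. *)
Record star_cuboid (C : category) (N : mor_class C) := StarCuboid {
  sc_P : C; sc_V : C; sc_U : C;
  sc_Ew : C; sc_W : C; sc_Y : C;
  sc_Ec : C; sc_C : C; sc_A : C;
  sc_S : C; sc_D : C; sc_B : C;
  sc_pi1 : hom sc_P sc_V; sc_pi2 : hom sc_P sc_V; sc_lambda : hom sc_V sc_U;
  sc_w1 : hom sc_Ew sc_W; sc_w2 : hom sc_Ew sc_W; sc_w : hom sc_W sc_Y;
  sc_c1 : hom sc_Ec sc_C; sc_c2 : hom sc_Ec sc_C; sc_c : hom sc_C sc_A;
  sc_sigma1 : hom sc_S sc_D; sc_sigma2 : hom sc_S sc_D; sc_d : hom sc_D sc_B;
  sc_gbar : hom sc_Ec sc_S; sc_g : hom sc_C sc_D; sc_f : hom sc_A sc_B;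
  sc_dbar : hom sc_Ew sc_S; sc_delta : hom sc_W sc_D; sc_beta : hom sc_Y sc_B;
  sc_tau1 : hom sc_P sc_Ew; sc_nu1 : hom sc_V sc_W; sc_chi1 : hom sc_U sc_Y;
  sc_tau2 : hom sc_P sc_Ec; sc_nu2 : hom sc_V sc_C; sc_chi2 : hom sc_U sc_A;
  sc_w_exact : star_exact N sc_w1 sc_w2 sc_w;
  sc_c_exact : star_exact N sc_c1 sc_c2 sc_c;
  sc_sigma_star : is_star N sc_sigma1 sc_sigma2;
  sc_gbar_regular : regular_epi sc_gbar;
  sc_g_regular : regular_epi sc_g;
  sc_f_regular : regular_epi sc_f;
  sc_sigma1_gbar : sc_sigma1 ∘ sc_gbar = sc_g ∘ sc_c1;
  sc_sigma2_gbar : sc_sigma2 ∘ sc_gbar = sc_g ∘ sc_c2;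
  sc_sigma1_dbar : sc_sigma1 ∘ sc_dbar = sc_delta ∘ sc_w1;
  sc_sigma2_dbar : sc_sigma2 ∘ sc_dbar = sc_delta ∘ sc_w2;
  sc_d_g : sc_d ∘ sc_g = sc_f ∘ sc_c;
  sc_d_delta : sc_d ∘ sc_delta = sc_beta ∘ sc_w;
  sc_tau_star_pullback : is_star_pullback N sc_gbar sc_dbar sc_tau1 sc_tau2;
  sc_nu_star_pullback : is_star_pullback N sc_g sc_delta sc_nu1 sc_nu2;
  sc_chi_star_pullback : is_star_pullback N sc_f sc_beta sc_chi1 sc_chi2;
  sc_pi_star : is_star N sc_pi1 sc_pi2;
  sc_nu1_pi1 : sc_nu1 ∘ sc_pi1 = sc_w1 ∘ sc_tau1;
  sc_nu1_pi2 : sc_nu1 ∘ sc_pi2 = sc_w2 ∘ sc_tau1;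
  sc_nu2_pi1 : sc_nu2 ∘ sc_pi1 = sc_c1 ∘ sc_tau2;
  sc_nu2_pi2 : sc_nu2 ∘ sc_pi2 = sc_c2 ∘ sc_tau2;
  sc_chi1_lambda : sc_chi1 ∘ sc_lambda = sc_w ∘ sc_nu1;
  sc_chi2_lambda : sc_chi2 ∘ sc_lambda = sc_c ∘ sc_nu2
}.

Definition star_upper_cuboid_lemma (C : category) (N : mor_class C) : Prop :=
  forall K : star_cuboid N,
    star_exact N (sc_sigma1 K) (sc_sigma2 K) (sc_d K) ->
    star_exact N (sc_pi1 K) (sc_pi2 K) (sc_lambda K).

(* Main.v *)
Require Import Defs.
From Stdlib Require Import List ssreflect.

Set Implicit Arguments.
Unset Strict Implicit.
Unset Printing Implicit Defensive.

(** Under the hypotheses, [N] behaves like a distinguished subset of each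
    object.  A morphism into [X] lies in [N] exactly when it factors through
    the [N]-kernel of [1_X]; saturation says that an element of [N] lifts along
    a regular epimorphism to an element of [N] ([lift_ideal_along]); and the
    closure properties of trivial objects say that an element of a relation
    lies in [N] as soon as both of its components do ([jointly_monic_ideal]).
    In a regular category one may then argue with generalised elements:
    regular epimorphisms are the strong ones, and existence is understood after
    passing to a cover of the domain.

    For permutability implying the cuboid lemma, the upper row inherits the
    property of being a star-kernel from the lower row
    ([cuboid_upper_star_kernel]).  Since every regular epimorphism is the
    coequaliser of its star-kernel ([regular_epi_star_exact]), it remains to
    show that [lambda] is a regular epimorphism.  A lifting problem for
    [lambda] amounts to replacing a zigzag of a [c]-step out of [N] followed by
    a [g]-step by a zigzag of a [g]-step followed by a [c]-step, and this is
    permutability ([cuboid_upper_regular_epi]).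

    Conversely, each inclusion of [Eq(g) Eq(c)^*] in [Eq(c) Eq(g)^*] is the
    surjectivity of [lambda] in one particular star-cuboid, whose object [C] is
    the relation [Eq(g)] itself ([cuboid_lemma_star_permutes]).  The inclusion
    for the pair in the other order gives equality. *)

(** * Binary products and pullbacks *)

Lemma comp_precomp (C : category) (X Y Z T : C) (g : hom Y Z) (f : hom X Y)
    (h : hom X Z) : g ∘ f = h -> forall t : hom T X, g ∘ (f ∘ t) = h ∘ t.
Proof. by move=> <- t; rewrite comp_assoc. Qed.

(* Rewrites with an equation whose left-hand side is a binary composite,
   anywhere inside a longer composite. *)
Ltac cat_rw H :=
  rewrite -?comp_assoc;
  first [rewrite (comp_precomp H) | rewrite H];
  rewrite -?comp_assoc.

Definition pair_hom (i j : bool) : Set :=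
  match i, j with
  | true, true | false, false => unit
  | _, _ => Empty_set
  end.

Definition pair_category : category.
Proof.
refine (@Category bool pair_hom
  (fun i => match i return pair_hom i i with true => tt | false => tt end)
  (fun i j k => match i, j, k
     return pair_hom j k -> pair_hom i j -> pair_hom i k with
     | true, true, true | false, false, false => fun _ _ => tt
     | true, true, false => fun e _ => e
     | true, false, _ => fun _ e => match e with end
     | false, true, _ => fun _ e => match e with end
     | false, false, true => fun e _ => e
     end) _ _ _).
- by case; case=> [] [].
- by case; case=> [] [].
- by case; case; case; case=> [] [] [] [].
Defined.

Lemma pair_category_finite : finite_category pair_category.
Proof.
split; first by exists (true :: false :: nil); case=> /=; auto.
by case; case;
  first [exists (tt :: nil); case=> /=; auto; fail | exists nil; case].
Qed.

Definition pair_functor (C : category) (X Y : C) : functor pair_category C.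
Proof.
refine (@Functor pair_category C (fun b : bool => if b then X else Y)
  (fun i j : bool => match i, j return pair_hom i j ->
     hom (if i then X else Y) (if j then X else Y) with
     | true, true => fun _ => idm X
     | false, false => fun _ => idm Y
     | true, false | false, true => fun e => match e with end
     end) _ _).
- by case.
- by case; case; case=> [] [] [] /=; rewrite comp_idl.
Defined.

Lemma products_exist (C : category) (X Y : C) : finitely_complete C ->
  exists (P : C) (p1 : hom P X) (p2 : hom P Y), is_product p1 p2.
Proof.
move=> /(_ _ pair_category_finite (pair_functor X Y)) [P [p [_ univ]]].
exists P, (p true), (p false) => T t1 t2.
pose t := fun b : bool => match b return hom T (if b then X else Y) with
                          | true => t1 | false => t2 end.
have cone_t : is_cone (F := pair_functor X Y) t.
  by case; case=> [] [] /=; rewrite comp_idl.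
have [u [Hu uniq]] := univ T t cone_t.
exists u; split; first by split; [exact: (Hu true) | exact: (Hu false)].
by move=> v [v1 v2]; apply: uniq; case.
Qed.

Inductive cospan_ob : Set := CLeft | CRight | CBase.

Definition cospan_hom (i j : cospan_ob) : Set :=
  match i, j with
  | CLeft, CLeft | CRight, CRight | _, CBase => unit
  | _, _ => Empty_set
  end.

Definition cospan_category : category.
Proof.
refine (@Category cospan_ob cospan_hom
  (fun i => match i return cospan_hom i i with
     CLeft => tt | CRight => tt | CBase => tt end)
  (fun i j k => match i, j, k
     return cospan_hom j k -> cospan_hom i j -> cospan_hom i k with
     | CLeft, CLeft, _ | CRight, CRight, _ | CBase, CBase, _ => fun e _ => e
     | _, CBase, CBase => fun _ _ => tt
     | _, CBase, _ => fun e _ => match e with end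
     | _, _, _ => fun _ e => match e with end
     end) _ _ _).
- by case; case=> [] [].
- by case; case=> [] [].
- by case; case; case; case=> [] [] [] [].
Defined.

Lemma cospan_category_finite : finite_category cospan_category.
Proof.
split; first by exists (CLeft :: CRight :: CBase :: nil); case=> /=; auto.
by case; case;
  first [exists (tt :: nil); case=> /=; auto; fail | exists nil; case].
Qed.

Definition cospan_value (C : category) (X Y Z : C) (i : cospan_ob) : C :=
  match i with CLeft => X | CRight => Y | CBase => Z end.

Definition cospan_functor (C : category) (X Y Z : C) (f : hom X Z)
    (g : hom Y Z) : functor cospan_category C.
Proof.
refine (@Functor cospan_category C (cospan_value X Y Z)
  (fun i j : cospan_ob => match i, j return cospan_hom i j ->
     hom (cospan_value X Y Z i) (cospan_value X Y Z j) with
     | CLeft, CLeft => fun _ => idm X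
     | CRight, CRight => fun _ => idm Y
     | CBase, CBase => fun _ => idm Z
     | CLeft, CBase => fun _ => f
     | CRight, CBase => fun _ => g
     | _, _ => fun e => match e with end
     end) _ _).
- by case.
- by case; case; case=> [] [] [] /=; rewrite ?comp_idl ?comp_idr.
Defined.

Lemma pullbacks_exist (C : category) (X Y Z : C) (f : hom X Z) (g : hom Y Z) :
  finitely_complete C ->
  exists (P : C) (p1 : hom P X) (p2 : hom P Y), is_pullback f g p1 p2.
Proof.
move=> /(_ _ cospan_category_finite (cospan_functor f g)) [P [p [cone univ]]].
exists P, (p CLeft), (p CRight); split.
  by rewrite (cone CLeft CBase tt) (cone CRight CBase tt).
move=> T t1 t2 t12.
pose t := fun i => match i return hom T (cospan_value X Y Z i) with
                   | CLeft => t1 | CRight => t2 | CBase => f ∘ t1 end.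
have cone_t : is_cone (F := cospan_functor f g) t.
  by case; case=> [] [] /=; rewrite ?comp_idl.
have [u [Hu uniq]] := univ T t cone_t.
exists u; split; first by split; [exact: (Hu CLeft) | exact: (Hu CRight)].
move=> v [v1 v2]; apply: uniq; case=> //=.
by rewrite -(cone CLeft CBase tt) /= -comp_assoc v1.
Qed.

Definition jointly_monic (C : category) (R X Y : C) (r1 : hom R X)
    (r2 : hom R Y) : Prop :=
  forall (T : C) (u v : hom T R), r1 ∘ u = r1 ∘ v -> r2 ∘ u = r2 ∘ v -> u = v.

Lemma product_jointly_monic (C : category) (X Y P : C) (p1 : hom P X)
    (p2 : hom P Y) : is_product p1 p2 -> jointly_monic p1 p2.
Proof.
move=> prod T u v e1 e2.
have [w [_ uniq]] := prod T (p1 ∘ v) (p2 ∘ v).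
by rewrite -(uniq u) // -(uniq v).
Qed.

Lemma pullback_jointly_monic (C : category) (X Y Z P : C) (f : hom X Z)
    (g : hom Y Z) (p1 : hom P X) (p2 : hom P Y) :
  is_pullback f g p1 p2 -> jointly_monic p1 p2.
Proof.
move=> [sq pb] T u v e1 e2.
have [|w [_ uniq]] := pb T (p1 ∘ v) (p2 ∘ v); first by rewrite !comp_assoc sq.
by rewrite -(uniq u) // -(uniq v).
Qed.

Lemma relation_jointly_monic (C : category) (X Y : C) (R : span X Y) :
  finitely_complete C -> is_relation R -> jointly_monic (leg1 R) (leg2 R).
Proof.
move=> lim rel T u v e1 e2.
have [P [p1 [p2 prod]]] := products_exist X Y lim.
have [m [[m1 m2] _]] := prod _ (leg1 R) (leg2 R).
apply: (rel _ _ _ _ prod m1 m2); apply: (product_jointly_monic prod).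
- by rewrite !comp_assoc m1.
- by rewrite !comp_assoc m2.
Qed.

Lemma jointly_monic_relation (C : category) (X Y : C) (R : span X Y) :
  jointly_monic (leg1 R) (leg2 R) -> is_relation R.
Proof.
move=> jm P p1 p2 m _ m1 m2 T u v e.
by apply: jm; [rewrite -m1 | rewrite -m2]; rewrite -!comp_assoc e.
Qed.

(** * Covers in a regular category *)

(** These are the covers over which generalised elements are taken.
    Orthogonality to monos makes closure under composition and right
    cancellation immediate, which is not so for coequalisers; in a regular
    category the two notions agree. *)
Definition strong_epi (C : category) (X Y : C) (e : hom X Y) : Prop :=
  forall (A B : C) (m : hom A B) (u : hom X A) (v : hom Y B),
    mono m -> m ∘ u = v ∘ e -> exists d : hom Y A, m ∘ d = v.

Lemma strong_epi_comp (C : category) (X Y Z : C) (g : hom Y Z) (f : hom X Y) :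
  strong_epi g -> strong_epi f -> strong_epi (g ∘ f).
Proof.
move=> sg sf A B m u v mm e.
have [d Hd] : exists d, m ∘ d = v ∘ g.
  by apply: (sf _ _ m u) => //; rewrite e comp_assoc.
exact: (sg _ _ m d).
Qed.

Lemma strong_epi_cancel (C : category) (X Y Z : C) (g : hom Y Z)
    (f : hom X Y) : strong_epi (g ∘ f) -> strong_epi g.
Proof.
move=> s A B m u v mm e; apply: (s _ _ m (u ∘ f)) => //.
by rewrite !comp_assoc e.
Qed.

Lemma split_strong_epi (C : category) (X Y : C) (e : hom X Y) (s : hom Y X) :
  e ∘ s = idm Y -> strong_epi e.
Proof.
move=> es A B m u v mm E; exists (u ∘ s).
by rewrite comp_assoc E -comp_assoc es comp_idr.
Qed.

Lemma regular_epi_epi (C : category) (X Y T : C) (e : hom X Y)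
    (u v : hom Y T) : regular_epi e -> u ∘ e = v ∘ e -> u = v.
Proof.
move=> [S [s1 [s2 [eq univ]]]] E.
have [|w [_ uniq]] := univ T (v ∘ e); first by rewrite -!comp_assoc eq.
by rewrite -(uniq u) // -(uniq v).
Qed.

Lemma regular_strong_epi (C : category) (X Y : C) (e : hom X Y) :
  regular_epi e -> strong_epi e.
Proof.
move=> re A B m u v mm E.
have [S [s1 [s2 [eq univ]]]] := re.
have [|d [de _]] := univ A u.
  by apply: mm; rewrite !comp_assoc E -!comp_assoc eq.
by exists d; apply: (regular_epi_epi re); rewrite -E -comp_assoc de.
Qed.

(** The mono part is tested on a pair [u], [v] that it identifies: lifting
    both along the quotient of the kernel pair gives a pair in that kernel
    pair, and the cover over which the lifts live is epi. *)
Lemma regular_image (C : category) (X Y : C) (f : hom X Y) :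
  regular_category C ->
  exists (Q : C) (q : hom X Q) (m : hom Q Y),
    regular_epi q /\ mono m /\ m ∘ q = f.
Proof.
move=> [lim [coeq stable]].
have [E [e1 [e2 pb]]] := pullbacks_exist f f lim.
have [Q [q cq]] := coeq _ _ _ _ _ _ pb.
have rq : regular_epi q by exists E, e1, e2.
have [eq univ] := cq.
have [m [mq _]] := univ Y f (proj1 pb).
exists Q, q, m; split=> //; split=> // T u v E0.
have [P1 [x [a pb1]]] := pullbacks_exist q u lim.
have [P2 [y [b pb2]]] := pullbacks_exist q (v ∘ a) lim.
have ra := stable _ _ _ _ _ _ _ _ pb1 rq.
have rb := stable _ _ _ _ _ _ _ _ pb2 rq.
apply: (regular_epi_epi ra); apply: (regular_epi_epi rb).
have [qx _] := pb1; have [qy _] := pb2.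
have [|k [[k1 k2] _]] := proj2 pb P2 (x ∘ b) y.
  rewrite -mq; cat_rw qx; cat_rw qy.
  by cat_rw E0.
by rewrite -qx -qy -k2 -comp_assoc -k1 comp_assoc eq -comp_assoc.
Qed.

(** The mono part of the image of [f] becomes invertible, so [f] is a
    coequaliser like the regular epi part. *)
Lemma strong_regular_epi (C : category) (X Y : C) (f : hom X Y) :
  regular_category C -> strong_epi f -> regular_epi f.
Proof.
move=> reg sf.
have [Q [q [m [[S [s1 [s2 [eq univ]]]] [mm mq]]]]] := regular_image f reg.
have [|d md] := sf _ _ m q (idm Y) mm; first by rewrite comp_idl.
have dm : d ∘ m = idm Q.
  by apply: mm; rewrite comp_assoc md comp_idl comp_idr.
exists S, s1, s2; split; first by rewrite -mq -!comp_assoc eq.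
move=> T t E; have [u [uq uniq]] := univ T t E.
exists (u ∘ d); split; first by rewrite -mq; cat_rw dm; rewrite comp_idl.
move=> v vf; rewrite (uniq (v ∘ m)) -?comp_assoc ?mq //.
by rewrite md comp_idr.
Qed.

Lemma lift_along (C : category) (X Y T : C) (f : hom X Y) (y : hom T Y) :
  regular_category C -> regular_epi f ->
  exists (T' : C) (e : hom T' T) (x : hom T' X),
    strong_epi e /\ f ∘ x = y ∘ e.
Proof.
move=> [lim [_ stable]] rf.
have [P [x [e pb]]] := pullbacks_exist f y lim.
exists P, e, x; split; last by case: pb.
exact/regular_strong_epi/(stable _ _ _ _ _ _ _ _ pb rf).
Qed.

(** Inclusion of relations may be checked on a cover of the smaller one: the
    larger one is a mono into the product, and covers are orthogonal to it. *)
Lemma factor_through_relation (C : category) (X Y R T Q : C) (r1 : hom R X)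
    (r2 : hom R Y) (t1 : hom T X) (t2 : hom T Y) (e : hom Q T) (r : hom Q R) :
  finitely_complete C -> jointly_monic r1 r2 -> strong_epi e ->
  r1 ∘ r = t1 ∘ e -> r2 ∘ r = t2 ∘ e ->
  exists u : hom T R, r1 ∘ u = t1 /\ r2 ∘ u = t2.
Proof.
move=> lim jm se E1 E2.
have [P [p1 [p2 prod]]] := products_exist X Y lim.
have [m [[m1 m2] _]] := prod R r1 r2.
have [v [[v1 v2] _]] := prod T t1 t2.
have mm : mono m.
  move=> Z a b E.
  by apply: jm; [rewrite -m1 | rewrite -m2]; rewrite -!comp_assoc E.
have mr : m ∘ r = v ∘ e.
  by apply: (product_jointly_monic prod);
    rewrite !comp_assoc ?m1 ?m2 ?v1 ?v2.
have [u mu] := se _ _ m r v mm mr.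
by exists u; rewrite -m1 -m2 -!comp_assoc mu.
Qed.

(** * Morphisms in the ideal *)

Lemma ideal_precomp (C : category) (N : mor_class C) (X Y Z : C)
    (g : hom Y Z) (f : hom X Y) : ideal N -> N _ _ g -> N _ _ (g ∘ f).
Proof. by move=> idl Ng; apply: idl; left. Qed.

Lemma ideal_postcomp (C : category) (N : mor_class C) (X Y Z : C)
    (g : hom Y Z) (f : hom X Y) : ideal N -> N _ _ f -> N _ _ (g ∘ f).
Proof. by move=> idl Nf; apply: idl; right. Qed.

Lemma kernel_mono (C : category) (N : mor_class C) (X Y K : C) (f : hom X Y)
    (k : hom K X) : ideal N -> is_kernel N f k -> mono k.
Proof.
move=> idl [Nfk univ] T u v E.
have [|w [_ uniq]] := univ T (k ∘ v).
  by rewrite comp_assoc; apply: ideal_precomp.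
by rewrite -(uniq u) // -(uniq v).
Qed.

(** If both components of [t] factor through trivial objects, then [t] factors
    through the subobject of the product of these two objects cut out by the
    relation; products and subobjects of trivial objects are trivial. *)
Lemma jointly_monic_ideal (C : category) (N : mor_class C) (R X Y T : C)
    (r1 : hom R X) (r2 : hom R Y) (t : hom T R) :
  finitely_complete C -> ideal N -> enough_trivial_objects N ->
  trivial_closed_under_products N -> jointly_monic r1 r2 ->
  N _ _ (r1 ∘ t) -> N _ _ (r2 ∘ t) -> N _ _ t.
Proof.
move=> lim idl [factor [sub _]] tprod jm N1 N2.
have [T1 [a1 [b1 [triv1 E1]]]] := factor _ _ _ N1.
have [T2 [a2 [b2 [triv2 E2]]]] := factor _ _ _ N2.
have [P [p1 [p2 prodP]]] := products_exist T1 T2 lim.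
have [Q [q1 [q2 prodQ]]] := products_exist X Y lim.
have [r [[qr1 qr2] _]] := prodQ _ r1 r2.
have [b [[qb1 qb2] _]] := prodQ P (b1 ∘ p1) (b2 ∘ p2).
have [a [[pa1 pa2] _]] := prodP T a1 a2.
have [M [m1 [m2 pb]]] := pullbacks_exist r b lim.
have mm2 : mono m2.
  move=> Z u v E; apply: (pullback_jointly_monic pb) => //.
  by apply: jm; [rewrite -qr1 | rewrite -qr2]; rewrite -?comp_assoc;
    congr (_ ∘ _); rewrite !comp_assoc (proj1 pb) -!comp_assoc E.
have trivM := sub _ _ _ mm2 (tprod _ _ _ _ _ prodP triv1 triv2).
have ra : r ∘ t = b ∘ a.
  apply: (product_jointly_monic prodQ); rewrite !comp_assoc.
    by rewrite qr1 qb1 E1 -comp_assoc pa1.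
  by rewrite qr2 qb2 E2 -comp_assoc pa2.
have [u [[<- _] _]] := proj2 pb T t a ra.
rewrite -(comp_idr m1) -comp_assoc; apply: ideal_postcomp => //.
exact: ideal_precomp.
Qed.

(** Elements of the ideal factor through the [N]-kernels of identities, and a
    saturating morphism induces a cover between these. *)
Lemma lift_ideal_along (C : category) (N : mor_class C) (X Y T : C)
    (f : hom X Y) (y : hom T Y) :
  regular_category C -> ideal N -> with_kernels N -> saturating N f ->
  N _ _ y ->
  exists (T' : C) (e : hom T' T) (x : hom T' X),
    strong_epi e /\ N _ _ x /\ f ∘ x = y ∘ e.
Proof.
move=> reg idl ker sat Ny.
have [NX [nX kX]] := ker _ _ (idm X).
have [NY [nY kY]] := ker _ _ (idm Y).
have NnX : N _ _ nX by have [] := kX; rewrite comp_idl.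
have [|u [nu _]] := proj2 kY NX (f ∘ nX).
  by rewrite comp_idl; apply: ideal_postcomp.
have [|y' [ny _]] := proj2 kY T y; first by rewrite comp_idl.
have [T' [e [x [se E]]]] := lift_along y' reg (sat _ _ _ _ u kX kY nu).
exists T', e, (nX ∘ x); split=> //; split; first exact: ideal_precomp.
by rewrite comp_assoc -nu -comp_assoc E comp_assoc ny.
Qed.

(** * Star-kernels and stars of pullback relations *)

Lemma star_pullback_exists (C : category) (N : mor_class C) (W A D : C)
    (g : hom A D) (delta : hom W D) :
  finitely_complete C -> ideal N -> with_kernels N ->
  exists (P : C) (nu1 : hom P W) (nu2 : hom P A),
    is_star_pullback N g delta nu1 nu2.
Proof.
move=> lim idl ker.
have [Q [q1 [q2 pb]]] := pullbacks_exist delta g lim.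
have [K [k kk]] := ker _ _ q1.
exists K, (q1 ∘ k), (q2 ∘ k); split; first by case: kk.
split; first by rewrite !comp_assoc (proj1 pb).
move=> T t1 t2 Nt1 E.
have [q [[qt1 qt2] _]] := proj2 pb T t1 t2 E.
have [|u [ku _]] := proj2 kk T q; first by rewrite qt1.
exists u; split; first by rewrite -!comp_assoc ku.
move=> v [v1 v2]; apply: (kernel_mono idl kk); rewrite ku.
by apply: (pullback_jointly_monic pb); rewrite ?qt1 ?qt2 comp_assoc.
Qed.

Lemma star_pullback_jointly_monic (C : category) (N : mor_class C)
    (W A D P : C) (g : hom A D) (delta : hom W D) (nu1 : hom P W)
    (nu2 : hom P A) :
  ideal N -> is_star_pullback N g delta nu1 nu2 -> jointly_monic nu1 nu2.
Proof.
move=> idl [Nnu [sq univ]] T u v E1 E2.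
have [| |w [_ uniq]] := univ T (nu1 ∘ v) (nu2 ∘ v).
    exact: ideal_precomp.
  by rewrite !comp_assoc sq.
by rewrite -(uniq u) // -(uniq v).
Qed.

Lemma star_kernel_jointly_monic (C : category) (N : mor_class C) (S X Y : C)
    (f : hom X Y) (s1 s2 : hom S X) :
  ideal N -> is_star_kernel N f s1 s2 -> jointly_monic s1 s2.
Proof. by move=> idl; apply: star_pullback_jointly_monic. Qed.

Lemma star_kernel_exists (C : category) (N : mor_class C) (X Y : C)
    (f : hom X Y) :
  finitely_complete C -> ideal N -> with_kernels N ->
  exists (S : C) (s1 s2 : hom S X), is_star_kernel N f s1 s2.
Proof. exact: star_pullback_exists. Qed.

(** Any star that [f] coequalises factors through the star-kernel, so a
    morphism that identifies the star-kernel also identifies the star of which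
    [f] is the coequaliser. *)
Lemma regular_epi_star_exact (C : category) (N : mor_class C) (S X Y : C)
    (f : hom X Y) (s1 s2 : hom S X) :
  star_regular N -> regular_epi f -> is_star_kernel N f s1 s2 ->
  star_exact N s1 s2 f.
Proof.
move=> [_ [_ [_ stars]]] rf sk; split=> //.
have [R [r1 [r2 [Nr [Er univ]]]]] := stars _ _ _ rf.
have [_ [Es us]] := sk.
have [h [[h1 h2] _]] := us _ r1 r2 Nr Er.
split=> // T t E; apply: univ.
by rewrite -h1 -h2 !comp_assoc E.
Qed.

(** * Permutability in terms of generalised elements *)

(** [Eq(f) Eq(g)^* ≤ Eq(g) Eq(f)^*], read on generalised elements: an
    existential statement about an element holds when it is witnessed on a
    cover [e] of its domain. *)
Definition star_permutes (C : category) (N : mor_class C) (X Y Z : C)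
    (f : hom X Y) (g : hom X Z) : Prop :=
  forall (T : C) (a b z : hom T X), N _ _ a -> g ∘ a = g ∘ b -> f ∘ b = f ∘ z ->
  exists (T' : C) (e : hom T' T) (y : hom T' X),
    strong_epi e /\ f ∘ a ∘ e = f ∘ y /\ g ∘ y = g ∘ z ∘ e.

Lemma Eq_exists (C : category) (X Y : C) (f : hom X Y) : finitely_complete C ->
  exists E : span X X, is_Eq f E.
Proof.
by move=> /(pullbacks_exist f f) [E [e1 [e2 pb]]]; exists (Span e1 e2).
Qed.

Lemma rel_star_exists (C : category) (N : mor_class C) (X Y : C)
    (R : span X Y) :
  with_kernels N -> exists S : span X Y, is_rel_star N R S.
Proof.
move=> /(_ _ _ (leg1 R)) [K [k kk]].
by exists (Span (leg1 R ∘ k) (leg2 R ∘ k)), k.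
Qed.

Lemma rel_comp_exists (C : category) (X Y Z : C) (S : span Y Z)
    (R : span X Y) :
  regular_category C -> exists T : span X Z, is_rel_comp S R T.
Proof.
move=> reg; have [lim _] := reg.
have [Q [q1 [q2 pb]]] := pullbacks_exist (leg2 R) (leg1 S) lim.
have [P [p1 [p2 prod]]] := products_exist X Z lim.
have [h [[h1 h2] _]] := prod Q (leg1 R ∘ q1) (leg2 S ∘ q2).
have [I [e [m [re [mm me]]]]] := regular_image h reg.
exists (Span (p1 ∘ m) (p2 ∘ m)); split.
  apply: jointly_monic_relation => T u v /=; rewrite -!comp_assoc => E1 E2.
  exact/mm/(product_jointly_monic prod).
by exists Q, q1, q2, e; split=> //=; rewrite -!comp_assoc me.
Qed.

(** A composite relation is the image of a pullback, so the intermediate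
    element that witnesses membership exists only on a cover. *)
Lemma Eq_rel_star_elements (C : category) (N : mor_class C) (X Y Z : C)
    (f : hom X Y) (g : hom X Z) (Ef Eg Eg_star S : span X X) (T : C)
    (s : hom T (apex S)) :
  regular_category C -> ideal N -> is_Eq f Ef -> is_Eq g Eg ->
  is_rel_star N Eg Eg_star -> is_rel_comp Ef Eg_star S ->
  exists (T' : C) (e : hom T' T) (a y z : hom T' X),
    strong_epi e /\ N _ _ a /\ g ∘ a = g ∘ y /\ f ∘ y = f ∘ z /\
    leg1 S ∘ s ∘ e = a /\ leg2 S ∘ s ∘ e = z.
Proof.
move=> reg idl Hf Hg [n [[Nn _] [n1 n2]]].
move=> [_ [Q [q1 [q2 [e [pb [re [e1 e2]]]]]]]].
have [T' [c [x [sc E]]]] := lift_along s reg re.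
exists T', c, (leg1 Eg ∘ n ∘ q1 ∘ x), (leg2 Eg ∘ n ∘ q1 ∘ x),
  (leg2 Ef ∘ q2 ∘ x).
split=> //; split; first by rewrite -!(comp_assoc _ _ x) -(comp_assoc _ n);
  rewrite !comp_assoc; do 2! apply: ideal_precomp => //.
split; first by cat_rw (proj1 Hg).
split; first by rewrite -n2 (proj1 pb); cat_rw (proj1 Hf).
by split; rewrite -comp_assoc -E comp_assoc ?e1 ?e2 ?n1.
Qed.

Lemma Eq_rel_star_member (C : category) (N : mor_class C) (X Y Z : C)
    (f : hom X Y) (g : hom X Z) (Ef Eg Eg_star S : span X X) (T : C)
    (a y z : hom T X) :
  is_Eq f Ef -> is_Eq g Eg -> is_rel_star N Eg Eg_star ->
  is_rel_comp Ef Eg_star S ->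
  N _ _ a -> g ∘ a = g ∘ y -> f ∘ y = f ∘ z ->
  exists s : hom T (apex S), leg1 S ∘ s = a /\ leg2 S ∘ s = z.
Proof.
move=> Hf Hg [n [[Nn univ] [n1 n2]]].
move=> [_ [Q [q1 [q2 [e [pb [_ [e1 e2]]]]]]]] Na ga fy.
have [k [[k1 k2] _]] := proj2 Hg T a y ga.
have [|k' [nk _]] := univ T k; first by rewrite k1.
have [l [[l1 l2] _]] := proj2 Hf T y z fy.
have [|q [[qk ql] _]] := proj2 pb T k' l.
  by rewrite n2 -comp_assoc nk k2 l1.
exists (e ∘ q); rewrite !comp_assoc e1 e2 n1 -!comp_assoc.
by rewrite qk ql nk.
Qed.

Lemma two_star_permutable_star_permutes (C : category) (N : mor_class C)
    (X Y Z : C) (f : hom X Y) (g : hom X Z) :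
  regular_category C -> ideal N -> with_kernels N ->
  two_star_permutable N -> regular_epi f -> regular_epi g ->
  star_permutes N f g.
Proof.
move=> reg idl ker perm rf rg T a b z Na ga fb; have [lim _] := reg.
have [Ef Hf] := Eq_exists f lim; have [Eg Hg] := Eq_exists g lim.
have [Ef' Hf'] := rel_star_exists Ef ker.
have [Eg' Hg'] := rel_star_exists Eg ker.
have [S HS] := rel_comp_exists Ef Eg' reg.
have [R HR] := rel_comp_exists Eg Ef' reg.
have [u [_ [_ [_ [u1 u2]]]]] :=
  perm _ _ _ _ _ rf rg _ _ _ _ _ _ Hf Hf' Hg Hg' HS HR.
have [s [s1 s2]] := Eq_rel_star_member Hf Hg Hg' HS Na ga fb.
have [T' [e [a' [y [z' [se [_ [E1 [E2 [ea ez]]]]]]]]]] :=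
  Eq_rel_star_elements (u ∘ s) reg idl Hg Hf Hf' HR.
exists T', e, y; split=> //.
rewrite comp_assoc u1 s1 in ea; rewrite comp_assoc u2 s2 in ez.
by rewrite E2 -E1 -ea -ez !comp_assoc.
Qed.

Lemma star_permutes_rel_comp_le (C : category) (N : mor_class C) (X Y Z : C)
    (f : hom X Y) (g : hom X Z) (Ef Eg Ef_star Eg_star S R : span X X) :
  regular_category C -> ideal N -> star_permutes N f g ->
  is_Eq f Ef -> is_rel_star N Ef Ef_star ->
  is_Eq g Eg -> is_rel_star N Eg Eg_star ->
  is_rel_comp Ef Eg_star S -> is_rel_comp Eg Ef_star R ->
  exists u : hom (apex S) (apex R),
    leg1 R ∘ u = leg1 S /\ leg2 R ∘ u = leg2 S.
Proof.
move=> reg idl pfg Hf Hf' Hg Hg' HS HR; have [lim _] := reg.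
have [T [e [a [y [z [se [Na [E1 [E2 [ea ez]]]]]]]]]] :=
  Eq_rel_star_elements (idm _) reg idl Hf Hg Hg' HS.
have [T' [e' [y' [se' [F1 F2]]]]] := pfg _ _ _ _ Na E1 E2.
have [r [r1 r2]] : exists r : hom T' (apex R),
    leg1 R ∘ r = a ∘ e' /\ leg2 R ∘ r = z ∘ e'.
  by apply: (Eq_rel_star_member (y := y') Hg Hf Hf' HR);
    [exact: ideal_precomp | rewrite comp_assoc | rewrite F2 comp_assoc].
apply: (factor_through_relation (r := r) lim _ (strong_epi_comp se se')).
- by apply: relation_jointly_monic => //; case: HR.
- by rewrite r1 -ea comp_idr comp_assoc.
- by rewrite r2 -ez comp_idr comp_assoc.
Qed.

(** Equality of the two composites is the inclusion for [(f, g)] together with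
    the inclusion for [(g, f)]. *)
Lemma star_permutes_two_star_permutable (C : category) (N : mor_class C) :
  regular_category C -> ideal N ->
  (forall (X Y Z : C) (f : hom X Y) (g : hom X Z),
     regular_epi f -> regular_epi g -> star_permutes N f g) ->
  two_star_permutable N.
Proof.
move=> reg idl perm X Y Z f g rf rg Ef Eg Ef' Eg' S R Hf Hf' Hg Hg' HS HR.
have [lim _] := reg.
have [u [u1 u2]] := star_permutes_rel_comp_le reg idl (perm _ _ _ _ _ rf rg)
  Hf Hf' Hg Hg' HS HR.
have [v [v1 v2]] := star_permutes_rel_comp_le reg idl (perm _ _ _ _ _ rg rf)
  Hg Hg' Hf Hf' HR HS.
have jS := relation_jointly_monic lim (proj1 HS).
have jR := relation_jointly_monic lim (proj1 HR).
exists u, v; split.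
  by apply: jR; rewrite comp_assoc comp_idr ?u1 ?u2.
split; last by split.
by apply: jS; rewrite comp_assoc comp_idr ?v1 ?v2.
Qed.

(** * Star-cuboids and permutability *)

(** The upper row of a star-cuboid is always a star-kernel once the lower one
    is: [P] and the star-kernel of [lambda] consist of the same quadruples,
    as an element of a relation lies in the ideal when its components do. *)
Lemma cuboid_upper_star_kernel (C : category) (N : mor_class C)
    (K : star_cuboid N) :
  finitely_complete C -> ideal N -> enough_trivial_objects N ->
  trivial_closed_under_products N ->
  is_star_kernel N (sc_d K) (sc_sigma1 K) (sc_sigma2 K) ->
  is_star_kernel N (sc_lambda K) (sc_pi1 K) (sc_pi2 K).
Proof.
case: K => /= P V U Ew W Y Ec X A S D B pi1 pi2 la w1 w2 w c1 c2 c s1 s2 d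
  gb g f db de be tau1 nu1 chi1 tau2 nu2 chi2 [Hw _] [Hc _] _ _ _ _
  sg1 sg2 sd1 sd2 _ _ Htau Hnu Hchi Npi np11 np12 np21 np22 cl1 cl2
  lim idl enough tprod Hs.
have jw := star_kernel_jointly_monic idl Hw.
have jc := star_kernel_jointly_monic idl Hc.
have js := star_kernel_jointly_monic idl Hs.
have jtau := star_pullback_jointly_monic idl Htau.
have jnu := star_pullback_jointly_monic idl Hnu.
have jchi := star_pullback_jointly_monic idl Hchi.
have [Nw [Ew12 uw]] := Hw; have [Nc [Ec12 uc]] := Hc.
have [Ntau [Etau utau]] := Htau; have [Nnu [Enu unu]] := Hnu.
split=> //; split.
  apply: jchi.
    by cat_rw cl1; cat_rw cl1; rewrite np11 np12 !comp_assoc Ew12.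
  by cat_rw cl2; cat_rw cl2; rewrite np21 np22 !comp_assoc Ec12.
move=> T t1 t2 Nt1 E.
have Nnu2 : N _ _ (nu1 ∘ t2) by apply: ideal_precomp.
have [| |p [[wp1 wp2] _]] := uw T (nu1 ∘ t1) (nu1 ∘ t2).
    exact: ideal_precomp.
  by rewrite !comp_assoc -cl1 -!comp_assoc E.
have [| |q [[cq1 cq2] _]] := uc T (nu2 ∘ t1) (nu2 ∘ t2).
    exact: ideal_postcomp.
  by rewrite !comp_assoc -cl2 -!comp_assoc E.
(* Both legs of [p] lie in the ideal, the second because [nu1] does. *)
have Np : N _ _ p.
  apply: (jointly_monic_ideal lim idl enough tprod jw); last by rewrite wp2.
  by rewrite wp1; apply: ideal_precomp.
have [| |r [[tr1 tr2] _]] := utau T p q => //.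
  apply: js.
    by cat_rw sd1; cat_rw sg1; rewrite wp1 cq1; cat_rw Enu.
  by cat_rw sd2; cat_rw sg2; rewrite wp2 cq2; cat_rw Enu.
exists r; split.
  split; apply: jnu.
        by cat_rw np11; rewrite tr1.
      by cat_rw np21; rewrite tr2.
    by cat_rw np12; rewrite tr1.
  by cat_rw np22; rewrite tr2.
move=> v [v1 v2]; apply: jtau; rewrite ?tr1 ?tr2.
  by apply: jw; rewrite ?wp1 ?wp2 -?v1 -?v2; [cat_rw np11 | cat_rw np12].
by apply: jc; rewrite ?cq1 ?cq2 -?v1 -?v2; [cat_rw np21 | cat_rw np22].
Qed.

(** Given [y] in the ideal and [a] with [beta y = f a], lift [y] to [v] in the
    ideal and [a] to [x].  Then [delta v] and [g x] are related by [S], which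
    is the image under [g] of [Eq(c)^*]: some [k = (k1, k2)] there has
    [g k1 = delta v] and [g k2 = g x].  Permutability turns the path from [k1]
    through [k2] to [x] into one through an [x'] with [g x' = delta v] and
    [c x' = a], so [(v, x')] is the required element over [(y, a)]. *)
Lemma cuboid_upper_regular_epi (C : category) (N : mor_class C)
    (K : star_cuboid N) :
  star_regular N ->
  (forall (X Y : C) (f : hom X Y), regular_epi f -> saturating N f) ->
  two_star_permutable N ->
  is_star_kernel N (sc_d K) (sc_sigma1 K) (sc_sigma2 K) ->
  regular_epi (sc_lambda K).
Proof.
case: K => /= P V U Ew W Y Ec X A S D B pi1 pi2 la w1 w2 w c1 c2 c s1 s2 d
  gb g f db de be tau1 nu1 chi1 tau2 nu2 chi2 [_ cw] [Hc cc] _ rgb rg rf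
  sg1 sg2 _ _ dg dd _ Hnu Hchi _ _ _ _ _ cl1 cl2
  [reg [[_ idl] [ker _]]] sat perm Hs.
have rw : regular_epi w by exists Ew, w1, w2.
have rc : regular_epi c by exists Ec, c1, c2.
have jchi := star_pullback_jointly_monic idl Hchi.
have [Nchi [Echi _]] := Hchi.
have [T1 [e1 [v [se1 [Nv wv]]]]] :=
  lift_ideal_along reg idl ker (sat _ _ _ rw) Nchi.
have [T2 [e2 [x [se2 cx]]]] := lift_along (chi2 ∘ e1) reg rc.
have [||s [[ss1 ss2] _]] := proj2 (proj2 Hs) T2 (de ∘ v ∘ e2) (g ∘ x).
    by apply: ideal_precomp => //; apply: ideal_postcomp.
  by cat_rw dd; cat_rw wv; cat_rw dg; rewrite cx; cat_rw Echi.
have [T3 [e3 [k [se3 gk]]]] := lift_along s reg rgb.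
have gk1 : g ∘ (c1 ∘ k) = de ∘ v ∘ e2 ∘ e3.
  by rewrite -ss1 -comp_assoc -gk; cat_rw sg1.
have gk2 : g ∘ (c2 ∘ k) = g ∘ (x ∘ e3).
  by rewrite (comp_assoc g x) -ss2 -comp_assoc -gk; cat_rw sg2.
(* [x] is replaced by an element over [delta v] with the same image in [A]. *)
have [T4 [e4 [x' [se4 [gx' cx']]]]] : exists (T4 : C) (e4 : hom T4 T3)
    (x' : hom T4 X), strong_epi e4 /\
    g ∘ (c1 ∘ k) ∘ e4 = g ∘ x' /\ c ∘ x' = c ∘ (x ∘ e3) ∘ e4.
  apply: (two_star_permutable_star_permutes reg idl ker perm rg rc _ _ gk2).
    exact: ideal_precomp (proj1 Hc).
  by rewrite !comp_assoc (proj1 (proj2 Hc)).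
have [| |t [[t1 t2] _]] := proj2 (proj2 Hnu) T4 (v ∘ e2 ∘ e3 ∘ e4) x'.
    by do 3!apply: ideal_precomp => //.
  by rewrite -gx' gk1 -!comp_assoc.
apply: strong_regular_epi => //.
have lt : la ∘ t = e1 ∘ e2 ∘ e3 ∘ e4.
  apply: jchi.
    by cat_rw cl1; rewrite t1; cat_rw wv.
  by cat_rw cl2; rewrite t2 cx'; cat_rw cx.
apply: (@strong_epi_cancel _ _ _ _ _ t); rewrite lt.
by do 3![apply: strong_epi_comp => //].
Qed.

(** The cuboid used to recover permutability of [g] and [c] has as [sc_g] the
    first projection [Eq(g) -> X], and as [sc_c] the regular epi part of the
    map [c × c] on [Eq(g)].  Reflexivity of [Eq(g)] makes the map [sc_gbar]
    between the star-kernels split.  With the left face taken to be [1_X] and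
    [c], surjectivity of [sc_lambda] says that whenever [a] is in the ideal
    and [c a = c b] with [(b, z)] in [Eq(g)], there is [(a, y)] in [Eq(g)]
    with [c y = c z]. *)
Lemma cuboid_lemma_star_permutes (C : category) (N : mor_class C) (X Y Z : C)
    (g : hom X Y) (c : hom X Z) :
  star_regular N -> enough_trivial_objects N ->
  trivial_closed_under_products N -> star_upper_cuboid_lemma N ->
  regular_epi c -> star_permutes N g c.
Proof.
move=> sreg enough tprod cuboid rc.
have [reg [[lim idl] [ker _]]] := sreg.
have [E [p1 [p2 Hg]]] := pullbacks_exist g g lim.
have [ZZ [q1 [q2 prod]]] := products_exist Z Z lim.
have [h [[h1 h2] _]] := prod E (c ∘ p1) (c ∘ p2).
have [A [r [m [rr [mm mr]]]]] := regular_image h reg.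
have [S [s1 [s2 Hs]]] := star_kernel_exists c lim idl ker.
have [R [r1 [r2 Hr]]] := star_kernel_exists r lim idl ker.
have [I [i1 [i2 Hi]]] := star_kernel_exists (idm X) lim idl ker.
have js := star_kernel_jointly_monic idl Hs.
have [Ns [Es us]] := Hs; have [Nr [Er ur]] := Hr; have [Ni [Ei _]] := Hi.
have [dg [[pd1 pd2] _]] := proj2 Hg X (idm X) (idm X) eq_refl.
have sp1 : strong_epi p1 := split_strong_epi pd1.
have fr : q1 ∘ m ∘ r = c ∘ p1 by rewrite -comp_assoc mr.
have rf : regular_epi (q1 ∘ m).
  apply: strong_regular_epi => //; apply: (@strong_epi_cancel _ _ _ _ _ r).
  by rewrite fr; apply: strong_epi_comp => //; apply: regular_strong_epi.
have [| |gb [[gb1 gb2] _]] := us R (p1 ∘ r1) (p1 ∘ r2).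
    exact: ideal_postcomp.
  by rewrite !comp_assoc -fr -!comp_assoc Er.
(* The diagonal [dg] sends a [c]-related pair [(a, b)] to the pair of
   elements [(a, a)], [(b, b)] of [Eq(g)], which [r] identifies. *)
have rgb : regular_epi gb.
  have [| |k [[k1 k2] _]] := ur S (dg ∘ s1) (dg ∘ s2).
      exact: ideal_postcomp.
    apply: mm; apply: (product_jointly_monic prod); rewrite !comp_assoc.
      by rewrite fr -!(comp_assoc _ p1) pd1 comp_idr.
    by rewrite -(comp_assoc q2) mr h2 -!(comp_assoc _ p2) pd2 comp_idr.
  apply: strong_regular_epi => //; apply: (@split_strong_epi _ _ _ _ k).
  apply: js; rewrite comp_assoc comp_idr ?gb1 ?gb2 -comp_assoc ?k1 ?k2.
    by rewrite comp_assoc pd1 comp_idl.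
  by rewrite comp_assoc pd1 comp_idl.
have [| |db [[db1 db2] _]] := us I i1 i2 => //.
  by rewrite -(comp_idl i1) -(comp_idl i2) Ei.
have [P [t1 [t2 Ht]]] := star_pullback_exists gb db lim idl ker.
have [V [n1 [n2 Hn]]] := star_pullback_exists p1 (idm X) lim idl ker.
have [U [x1 [x2 Hx]]] := star_pullback_exists (q1 ∘ m) c lim idl ker.
have [Nt [Et _]] := Ht; have [Nn [En un]] := Hn; have [Nx [Ex ux]] := Hx.
have jn := star_pullback_jointly_monic idl Hn.
have jx := star_pullback_jointly_monic idl Hx.
have [| |pi1 [[np11 np21] _]] := un P (i1 ∘ t1) (r1 ∘ t2).
    exact: ideal_postcomp.
  by rewrite comp_idl -db1 -comp_assoc Et !comp_assoc gb1.
have [| |pi2 [[np12 np22] _]] := un P (i2 ∘ t1) (r2 ∘ t2).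
    exact: ideal_postcomp.
  by rewrite comp_idl -db2 -comp_assoc Et !comp_assoc gb2.
have Npi : N _ _ pi1.
  apply: (jointly_monic_ideal lim idl enough tprod jn).
    by rewrite np11; apply: ideal_postcomp.
  by rewrite np21; apply: ideal_precomp.
have [| |la [[xl1 xl2] _]] := ux V (idm X ∘ n1) (r ∘ n2).
    by rewrite comp_idl.
  by rewrite En !comp_assoc fr.
have id_exact := regular_epi_star_exact sreg
  (strong_regular_epi reg (split_strong_epi (comp_idl (idm X)))) Hi.
have r_exact := regular_epi_star_exact sreg rr Hr.
have c_exact := regular_epi_star_exact sreg rc Hs.
have dc : c ∘ idm X = c ∘ idm X by [].
have sd1 : s1 ∘ db = idm X ∘ i1 by rewrite comp_idl.
have sd2 : s2 ∘ db = idm X ∘ i2 by rewrite comp_idl.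
(* The lower row is the star-kernel of [c] followed by [c]. *)
have [_ cl] := cuboid
  (StarCuboid id_exact r_exact Ns rgb (strong_regular_epi reg sp1) rf
     gb1 gb2 sd1 sd2 (eq_sym fr) dc Ht Hn Hx Npi np11 np12 np21 np22 xl1 xl2)
  c_exact.
have rl : regular_epi la by exists P, pi1, pi2.
move=> T a b z Na cab gbz.
have [j [[j1 j2] _]] := proj2 Hg T b z gbz.
(* [j] is the element [(b, z)] of [Eq(g)]; an element of [V] above
   [(a, r j)] is the required pair [(a, y)] in [Eq(g)]. *)
have [|u [[u1 u2] _]] := ux T a (r ∘ j) Na.
  by rewrite cab -j1 !comp_assoc fr.
have [T' [e [t [se lt]]]] := lift_along u reg rl.
exists T', e, (p2 ∘ (n2 ∘ t)); split=> //; split.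
  rewrite -(comp_assoc g a); have <- : n1 ∘ t = a ∘ e.
    by rewrite -u1 -comp_assoc -lt; cat_rw xl1; rewrite comp_idl.
  rewrite !(comp_assoc g p2) -(proj1 Hg) -(comp_assoc g p1) (comp_assoc p1 n2).
  by rewrite -En comp_idl.
rewrite -j2 !(comp_assoc c) -h2 -mr.
have -> : q2 ∘ (m ∘ r) ∘ (n2 ∘ t) = q2 ∘ m ∘ (x2 ∘ (la ∘ t)).
  by cat_rw xl2.
by rewrite lt (comp_assoc x2) u2 -!comp_assoc.
Qed.

Theorem theorem3p3 (C : category) (N : mor_class C)
  (star_reg : star_regular N)
  (saturating_regepi : forall (X Y : C) (f : hom X Y),
     regular_epi f -> saturating N f)
  (enough_trivial : enough_trivial_objects N)
  (trivial_products : trivial_closed_under_products N) :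
  two_star_permutable N <-> star_upper_cuboid_lemma N.
Proof.
have [reg [[lim idl] _]] := star_reg.
split=> [perm K [Hs _] | cuboid].
  apply: regular_epi_star_exact => //.
    exact: cuboid_upper_regular_epi.
  exact: cuboid_upper_star_kernel.
apply: star_permutes_two_star_permutable => // X Y Z f g _ rg.
exact: cuboid_lemma_star_permutes.
Qed.
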